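(* Let $(X,d)$ be a compact metric space and let $(X,\mathbb{F})$ be the non-autonomous dynamical system generated by a commutative family $\mathbb{F}=\{f_n:n\in\mathbb{N}\}$ of homeomorphisms of $X$. Then $(X,\mathbb{F})$ is topologically transitive if and only if there is a point $x\in X$ whose orbit $\mathcal{O}(x)$ is dense in $X$.
   Context: $X$ is non-empty and $\mathbb{N}=\{1,2,3,\dots\}$. The family $\mathbb{F}$ is commutative if $f_n\circ f_m=f_m\circ f_n$ for all $n,m$. The non-autonomous system $(X,\mathbb{F})$ has time-$n$ states $\omega_n(x)$, $n\in\mathbb{Z}$, defined by $\omega_0(x)=x$, $\omega_n(x)=f_n(\omega_{n-1}(x))$ for $n\ge 1$, and $\omega_n(x)=f_{-n}^{-1}(\omega_{n+1}(x))$ for $n<0$; thus $\omega_n=f_n\circ\cdots\circ f_1$ and $\omega_{-n}=f_n^{-1}\circ\cdots\circ f_1^{-1}$ for $n\geq 1$. The orbit of $x$ is $\mathcal{O}(x)=\{\omega_n(x):n\in\mathbb{Z}\}$. $(X,\mathbb{F})$ is topologically transitive if for every pair of non-empty open sets $U,V$ in $X$ there exists $k\in\mathbb{Z}$ such that $\omega_k(U)\cap V\neq\emptyset$. *)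

(* Defs.v *)
From HB Require Import structures.
From mathcomp Require Import all_boot all_order all_algebra.
From mathcomp Require Import all_classical all_reals all_analysis.

Set Implicit Arguments.
Unset Strict Implicit.
Unset Printing Implicit Defensive.

Local Open Scope classical_set_scope.

(* A [splitbij] is a bijection carrying its two-sided inverse [f^-1]. *)
Definition homeomorphism (X : topologicalType)
    (f : {splitbij [set: X] >-> [set: X]}) : Prop :=
  continuous f /\ continuous f^-1.

(* Families are indexed by the integers n >= 1: the value at 0 is never used,
   neither in the hypotheses on the family nor in [omega]. *)
Definition homeomorphism_family (X : topologicalType)
    (f : nat -> {splitbij [set: X] >-> [set: X]}) : Prop :=
  forall n, (0 < n)%N -> homeomorphism (f n).

Definition commutative_family (X : Type)
    (f : nat -> {splitbij [set: X] >-> [set: X]}) : Prop :=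
  forall n m, (0 < n)%N -> (0 < m)%N -> f n \o f m = f m \o f n.

Fixpoint forward_state (X : Type)
    (f : nat -> {splitbij [set: X] >-> [set: X]}) (n : nat) (x : X) : X :=
  if n is m.+1 then f m.+1 (forward_state f m x) else x.

Fixpoint backward_state (X : Type)
    (f : nat -> {splitbij [set: X] >-> [set: X]}) (n : nat) (x : X) : X :=
  if n is m.+1 then (f m.+1)^-1 (backward_state f m x) else x.

(* [Negz m] is the integer -(m + 1). *)
Definition omega (X : Type) (f : nat -> {splitbij [set: X] >-> [set: X]})
    (k : int) (x : X) : X :=
  match k with
  | Posz n => forward_state f n x
  | Negz m => backward_state f m.+1 x
  end.

Definition state_orbit (X : Type) (f : nat -> {splitbij [set: X] >-> [set: X]})
    (x : X) : set X :=
  [set omega f k x | k in [set: int]].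

Definition topologically_transitive (X : topologicalType)
    (f : nat -> {splitbij [set: X] >-> [set: X]}) : Prop :=
  forall U V : set X, open U -> open V -> U !=set0 -> V !=set0 ->
  exists k : int, (omega f k @` U) `&` V !=set0.

(* Main.v *)
Require Import Defs.
From HB Require Import structures.
From mathcomp Require Import all_boot all_order all_algebra.
From mathcomp Require Import all_classical all_reals all_analysis.

(** If [x] has a dense orbit and [omega m x] lies in [U], then density applied
    to the preimage of [V] under [omega m] gives [k] with
    [omega m (omega k x)] in [V]; all states commute, so [omega k] sends
    [omega m x] into [V]. Conversely, transitivity says that for each member
    of a countable basis the points whose orbit meets it form a dense open
    set, and Baire's theorem yields a point in all of these sets. *)

Local Open Scope classical_set_scope.

(* [Baire] in the library covers complete normed modules only. *)
Lemma compact_regular_Baire (T : topologicalType) (F : nat -> set T) :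
  compact [set: T] -> regular_space T ->
  (forall i, open (F i) /\ dense (F i)) -> dense (\bigcap_i F i).
Proof.
move=> Tcompact Tregular Fod D D0 Dopen.
(* The pair holds a stage and the current open set. Density makes the intersection nonempty, and
   regularity fits a closed neighbourhood inside it. The hypotheses sit under the existential so
   that [choice] yields a total [g]; [set0] is a dummy value. *)
have shrink (p : nat * set T) : exists B : set T,
    open p.2 -> p.2 !=set0 ->
    [/\ open B, B !=set0 & closure B `<=` p.2 `&` F p.1].
  have [[pop pne]|pN] := pselect (open p.2 /\ p.2 !=set0); last first.
    by exists set0 => pop pne; case: pN.
  have [Fop Fdense] := Fod p.1.
  have [a pFa] := Fdense _ pne pop.
  have : nbhs a (p.2 `&` F p.1).
    by apply: open_nbhs_nbhs; split => //; exact: openI.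
  move=> /(Tregular a) [N aN NpF]; exists N° => _ _; split.
  - exact: open_interior.
  - by exists a.
  - apply: subset_trans NpF; apply: closureS; exact: interior_subset.
have [g gP] := choice shrink.
pose A := fix A n := if n is m.+1 then g (m, A m) else D.
have AP n : open (A n) /\ A n !=set0.
  by elim: n => [|n [Aop Ane]] //=; have [] := gP (n, A n) Aop Ane.
have AS n : closure (A n.+1) `<=` A n `&` F n.
  by have [Aop Ane] := AP n; have [] := gP (n, A n) Aop Ane.
have Adecr m n : (m <= n)%N -> A n `<=` A m.
  elim: n => [|n IHn]; first by rewrite leqn0 => /eqP ->.
  rewrite leq_eqVlt => /orP[/eqP -> //|/IHn]; apply: subset_trans.
  by move=> x /subset_closure /AS [].
(* The nested nonempty sets form a filter base; compactness gives it a cluster point, which lies in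
   every [closure (A n)]. *)
have Aproper : ProperFilter (filter_from [set: nat] A).
  apply: filter_from_proper => [|n _]; last by have [] := AP n.
  apply: filter_from_filter => [|i j _ _]; first by exists 0%N.
  exists (maxn i j) => // x Ax; split.
  - exact: (Adecr _ _ (leq_maxl i j)).
  - exact: (Adecr _ _ (leq_maxr i j)).
have [|p [_ pA]] := Tcompact _ Aproper; first by exists 0%N.
have pcl n : closure (A n) p by move=> N pN; apply: pA => //; exists n.
(* The index shifts by one: [closure (A n.+1)] lies in [F n], and [closure (A 1)] lies in [A 0],
   that is [D]. *)
exists p; split; first by have [] := AS 0%N p (pcl 1%N).
by move=> n _; have [] := AS n p (pcl n.+1).
Qed.

Section States.
Context {X : Type} (f : nat -> {splitbij [set: X] >-> [set: X]}).

Lemma splitbij_inv_comm (h : {splitbij [set: X] >-> [set: X]}) (g : X -> X) :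
  (forall x, g (h x) = h (g x)) -> forall x, g (h^-1 x) = h^-1 (g x).
Proof.
move=> gh x; rewrite -{2}(invK (f := h) (in_setT x)) gh.
by rewrite (funK (s := h) (in_setT _)).
Qed.

(** Commuting with a bijection entails commuting with its inverse, so induction reaches both time
    directions. Leaving [g] arbitrary allows two uses: with a generator [f n], then with a whole
    state [omega f j]. *)
Lemma omega_comm_with (g : X -> X) :
  (forall n, (0 < n)%N -> forall x, g (f n x) = f n (g x)) ->
  forall k x, g (omega f k x) = omega f k (g x).
Proof.
move=> gf [] n x.
- by elim: n => //= n <-; exact: gf.
- rewrite /omega; elim: n.+1 => //= {}n <-.
  by apply: splitbij_inv_comm => y; exact: gf.
Qed.

Lemma omega_comm : commutative_family f ->
  forall j k x, omega f j (omega f k x) = omega f k (omega f j x).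
Proof.
move=> fcomm j; apply: omega_comm_with => n n0 x; apply/esym.
by apply: omega_comm_with => m m0 y; have /(congr1 (@^~ y)) := fcomm n m n0 m0.
Qed.

Lemma omega_surj k y : exists x, omega f k x = y.
Proof.
case: k => n; rewrite /omega.
- elim: n y => [|n IHn] y; first by exists y.
  by have [x xy] := IHn ((f n.+1)^-1 y); exists x; rewrite /= xy invK// in_setT.
- elim: n.+1 y => {n} [|n IHn] y; first by exists y.
  by have [x xy] := IHn (f n.+1 y); exists x; rewrite /= xy funK// in_setT.
Qed.

End States.

Lemma omega_continuous (X : topologicalType)
    (f : nat -> {splitbij [set: X] >-> [set: X]}) :
  homeomorphism_family f -> forall k, continuous (omega f k).
Proof.
move=> fh [] n; rewrite /omega.
- elim: n => [|n IHn] x; first exact: cvg_id.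
  apply: (continuous_comp (IHn x)).
  by have [fc _] := fh n.+1 isT; exact: fc.
- elim: n.+1 => {n} [|n IHn] x; first exact: cvg_id.
  apply: (continuous_comp (IHn x)).
  by have [_ fc] := fh n.+1 isT; exact: fc.
Qed.

Lemma dense_orbit_transitive (X : topologicalType)
    (f : nat -> {splitbij [set: X] >-> [set: X]}) (x : X) :
  homeomorphism_family f -> commutative_family f ->
  dense (state_orbit f x) -> topologically_transitive f.
Proof.
move=> fh fcomm xdense U V Uop Vop U0 [v Vv].
have [y [Uy [m _ xy]]] := xdense U U0 Uop.
have Wop : open (omega f m @^-1` V).
  by apply: open_comp => // ? _; exact: omega_continuous.
(* Every state map is onto, so the preimage of a nonempty set is nonempty. *)
have W0 : (omega f m @^-1` V) !=set0.
  by have [w wv] := omega_surj f m v; exists w; rewrite /= wv.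
have [z [Vz [k _ xz]]] := xdense _ W0 Wop.
exists k, (omega f k y); split; first by exists y.
by rewrite -xy omega_comm// xz.
Qed.

Lemma transitive_dense_orbit (X : topologicalType)
    (f : nat -> {splitbij [set: X] >-> [set: X]}) :
  [set: X] !=set0 -> compact [set: X] -> regular_space X ->
  @second_countable X -> homeomorphism_family f ->
  topologically_transitive f -> exists x : X, dense (state_orbit f x).
Proof.
move=> [x0 _] Xcompact Xregular [B Bcount [Bopen Bbasis]] fh ftrans.
(* Either the basis is empty, which the point [x0] excludes, or [e] enumerates it. *)
have [B0|/unsquash e] := pfcard_geP Bcount.
  by have [V [+ _] _] := Bbasis x0 setT filterT; rewrite B0.
have eB n : B (e n) by exact: funS.
(* The basis may contain the empty set, which no orbit meets; the guard turns [G n] into the whole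
   space in that case. *)
pose G n := [set x | e n !=set0 -> exists k, e n (omega f k x)].
have Gdense : dense (\bigcap_n G n).
  apply: compact_regular_Baire => // n; split.
  - have [en0|enN] := pselect (e n !=set0); last first.
      suff -> : G n = setT by exact: openT.
      by apply/seteqP; split => // x _ /enN.
    have -> : G n = \bigcup_k (omega f k @^-1` e n).
      apply/seteqP; split => [x /(_ en0) [k kx]|x [k _ kx] _].
        by exists k.
      by exists k.
    apply: bigcup_open => k _; apply: open_comp; last exact: Bopen.
    by move=> ? _; exact: omega_continuous.
  - move=> D D0 Dop.
    have [en0|enN] := pselect (e n !=set0); last first.
      by have [x Dx] := D0; exists x; split => // /enN.
    have [k [y [[x Dx xy] eky]]] := ftrans D (e n) Dop (Bopen _ (eB n)) D0 en0.
    by exists x; split => // _; exists k; rewrite xy.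
have [x [_ Gx]] := Gdense setT (ex_intro _ x0 I) openT.
exists x => V [v Vv] Vop.
have [W [BW Wv] WV] := Bbasis v V (open_nbhs_nbhs (conj Vop Vv)).
have [n _ enW] : (e @` setT) W by exact: surj.
have [|k ekx] := Gx n I; first by exists v; rewrite enW.
by exists (omega f k x); split; [apply: WV; rewrite -enW | exists k].
Qed.

Theorem proposition9 (R : realType) (X : metricType R)
    (X_nonempty : [set: X] !=set0) (X_compact : compact [set: X])
    (f : nat -> {splitbij [set: X] >-> [set: X]})
    (f_homeo : homeomorphism_family f) (f_comm : commutative_family f) :
  topologically_transitive f <-> exists x : X, dense (state_orbit f x).
Proof.
split=> [|[x]]; last exact: dense_orbit_transitive.
apply: transitive_dense_orbit => //; first exact: uniform_regular.
(* [compact_second_countable] is stated for pointed spaces. *)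
have [x0 _] := X_nonempty.
(* [T] is [X] with base point [x0] and the same topology. *)
pose T : pseudoPMetricType R := HB.pack X (isPointed.Build X x0).
exact: (@compact_second_countable R T).
Qed.
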